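(* Let $k \ge 2$, $t \ge 1$ and $n \ge 1$ be integers, let $c_1, \dots, c_{k-1}$ be positive integers, and let $b$ be a positive integer. Let $\mathcal{E}(b)$ denote the equation \[ c_1x_1+c_2x_2+\dots+c_{k-1}x_{k-1} = x_k + b. \] Let $s = \sum_{i=1}^{k-1} c_i - 1$. If $s \mid b$ and there is a $t$-coloring of the interval $[1,n]$ which satisfies the excellence condition (for $c_1,\dots,c_{k-1}$), then \[ r(\mathcal{E}(b);t) \ge \frac{b}{s} - \left\lceil \frac{b}{s\cdot (n+1)} \right\rceil + 1. \]
   Context: For a positive integer $n$, $[1,n]=\{1,2,\dots,n\}$; a $t$-coloring of $[1,n]$ is a map from $[1,n]$ to a set of $t$ colors. A monochromatic (''mono'') solution to an equation in the variables $x_1,\dots,x_k$ is a $k$-tuple $(x_1,\dots,x_k)$ of elements of the interval, not necessarily distinct, that satisfies the equation and whose entries all have the same color. For a linear equation $\mathcal{E}$, the $t$-color Rado number $r(\mathcal{E};t)$ is the least positive integer $r$, if it exists, such that every $t$-coloring of $[1,r]$ admits a monochromatic solution to $\mathcal{E}$; if no such integer exists we set $r(\mathcal{E};t)=\infty$. Excellence condition: given positive integers $c_1,\dots,c_{k-1}$ and $s=\sum_{i=1}^{k-1}c_i-1$, a coloring of $[1,n]$ satisfies the excellence condition if, for every integer $j$ with $0\le j\le s$, it does not contain any monochromatic solution to $c_1x_1+c_2x_2+\dots+c_{k-1}x_{k-1}+j=x_k$ (with all $x_i\in[1,n]$). $s \mid b$ means $b = sq$ for some integer $q$; since $b>0$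 this forces $s \ge 1$. *)

(* Defs.v *)
From HB Require Import structures.
From mathcomp Require Import all_boot all_order all_algebra.
From mathcomp Require Import boolp constructive_ereal.
Set Implicit Arguments.
Unset Strict Implicit.
Unset Printing Implicit Defensive.
Import Order.TTheory GRing.Theory Num.Theory.

Definition interval (n : nat) : Type := {x : nat | 0 < x <= n}.

Definition coloring (n t : nat) : Type := interval n -> 'I_t.

(* An equation in p variables is given by the predicate "x is a solution". *)
Definition equation (p : nat) : Type := ('I_p -> nat) -> Prop.

Definition has_mono_solution (p n t : nat) (E : equation p)
    (chi : coloring n t) : Prop :=
  exists x : 'I_p -> interval n,
    E (fun i => val (x i)) /\ (forall i j, chi (x i) = chi (x j)).

Definition unavoidable (p : nat) (E : equation p) (t r : nat) : Prop :=
  0 < r /\ forall chi : coloring r t, has_mono_solution E chi.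

Definition rado_number (p : nat) (E : equation p) (t : nat) : \bar rat :=
  match pselect (exists r : nat, `[< unavoidable E t r >]) with
  | left h => ((ex_minn h)%:R%R)%:E%E
  | right _ => +oo%E
  end.

(* Below m = k - 1; the variables x_1, ..., x_k are x 0, ..., x m, so that
   x ord_max is x_k. *)

Definition lin_form (m : nat) (c : 'I_m -> nat) (x : 'I_m.+1 -> nat) : nat :=
  \sum_(i < m) c i * x (widen_ord (leqnSn m) i).

Definition eq_b (m : nat) (c : 'I_m -> nat) (b : nat) : equation m.+1 :=
  fun x => lin_form c x = x ord_max + b.

Definition eq_shift (m : nat) (c : 'I_m -> nat) (j : nat) : equation m.+1 :=
  fun x => lin_form c x + j = x ord_max.

(* The subtraction is truncated; it is exact when m > 0 and all c i > 0. *)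
Definition coef_s (m : nat) (c : 'I_m -> nat) : nat := \sum_(i < m) c i - 1.

Definition excellent (m : nat) (c : 'I_m -> nat) (n t : nat)
    (chi : coloring n t) : Prop :=
  forall j : nat, j <= coef_s c -> ~ has_mono_solution (eq_shift c j) chi.

(* Main.v *)
Require Import Defs.
From mathcomp Require Import all_boot all_order all_algebra.
From mathcomp Require Import boolp constructive_ereal.
From mathcomp Require Import zify.

(** Write [b = s * q] and substitute [x = q - y].  The coefficients on the left
    of [c_1 x_1 + ... + c_(k-1) x_(k-1) = x_k + b] sum to [s + 1], so the
    constants cancel and the [y_i] satisfy the homogeneous equation
    [c_1 y_1 + ... + c_(k-1) y_(k-1) = y_k] ([lin_form_reflect]).

    Let [d = ceil (q / (n + 1))].  When [x] runs over [1, q - d], the reflected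
    point [y] runs over [d, q - 1], which is covered by the [n] blocks
    [d z, d z + d - 1], [1 <= z <= n].  Give [x] the color that the excellent
    coloring gives to the block number [z] of [y].  Dividing a solution of the
    homogeneous equation by [d] and rounding down leaves a carry of at most
    [s], because the [s + 1] remainders (with multiplicity) are each below [d]
    ([lin_form_divn]).  Hence a monochromatic solution of the original equation
    would give a monochromatic solution of one of the equations forbidden by
    excellence ([excellent_avoids_eq_b]).  So [1, q - d] has a coloring without
    monochromatic solutions, and the Rado number exceeds [q - d]. *)

Lemma sum_coef {m} (c : 'I_m -> nat) :
  0 < coef_s c -> \sum_(i < m) c i = (coef_s c).+1.
Proof. by rewrite /coef_s; lia. Qed.

(** The left-hand coefficients sum to [s + 1], so reflecting every variable in
    [q] contributes [(s + 1) * q] on the left and [q + s * q] on the right. *)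
Lemma lin_form_reflect {m} {c : 'I_m -> nat} {q} {x : 'I_m.+1 -> nat} :
  0 < coef_s c -> (forall i, x i <= q) ->
  eq_b c (coef_s c * q) x -> Defs.eq_shift c 0 (fun i => q - x i).
Proof.
move=> s_gt0 le_xq; rewrite /eq_b /Defs.eq_shift addn0 => sol.
have: lin_form c (fun i => q - x i) + lin_form c x = (coef_s c).+1 * q.
  rewrite /lin_form -big_split /= -sum_coef // big_distrl /=.
  by apply: eq_bigr => i _; rewrite -mulnDr subnK.
by rewrite sol mulSn; have := le_xq ord_max; lia.
Qed.

(** The carry [j] is the quotient by [d] of the sum of the remainders with
    coefficients [c]; that sum is below [(s + 1) * d]. *)
Lemma lin_form_divn {m} {c : 'I_m -> nat} {d} {y : 'I_m.+1 -> nat} :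
  0 < d -> 0 < coef_s c -> Defs.eq_shift c 0 y ->
  exists2 j, j <= coef_s c & Defs.eq_shift c j (fun i => y i %/ d).
Proof.
move=> d_gt0 s_gt0; rewrite /Defs.eq_shift addn0 => sol.
set rem := lin_form c (fun i => y i %% d).
have split_y : y ord_max = lin_form c (fun i => y i %/ d) * d + rem.
  rewrite -sol /rem /lin_form big_distrl -big_split /=.
  by apply: eq_bigr => i _; rewrite -mulnA -mulnDr -divn_eq.
exists (rem %/ d); last by rewrite split_y divnMDl.
rewrite -ltnS ltn_divLR // -sum_coef //.
have le_rem : rem <= (\sum_(i < m) c i) * d.-1.
  rewrite /rem /lin_form big_distrl leq_sum // => i _.
  by rewrite leq_mul2l -ltnS prednK // ltn_pmod ?orbT.
apply: leq_ltn_trans le_rem _.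
by rewrite ltn_mul2l sum_coef //= prednK.
Qed.

(** The color of [x] is that of the block number [(q - x) %/ d]; the bound
    [r + d <= q] keeps this number positive, and [q <= d * n.+1] keeps it at
    most [n]. *)
Lemma excellent_avoids_eq_b {m} {c : 'I_m -> nat} {n t q d r}
    {chi : coloring n t} :
  excellent c chi -> 0 < coef_s c -> 0 < d -> q <= d * n.+1 -> r + d <= q ->
  exists chi' : coloring r t, ~ has_mono_solution (eq_b c (coef_s c * q)) chi'.
Proof.
move=> exc s_gt0 d_gt0 q_le r_le.
have block_bounds (x : Defs.interval r) : 0 < (q - val x) %/ d <= n.
  have /andP[x_gt0 x_le] := valP x.
  rewrite divn_gt0 // -[_ %/ _ <= n]ltnS ltn_divLR // [n.+1 * d]mulnC.
  by apply/andP; split; lia.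
pose block x : Defs.interval n :=
  exist (fun z => is_true (0 < z <= n)) _ (block_bounds x).
exists (fun x => chi (block x)) => -[x [sol mono]].
have le_xq i : val (x i) <= q by have /andP[_] := valP (x i); lia.
have sol_y := lin_form_reflect s_gt0 le_xq sol.
have [j j_le sol_z] := lin_form_divn d_gt0 s_gt0 sol_y.
by apply: (exc j j_le); exists (fun i => block (x i)).
Qed.

Lemma rado_number_ge p (E : equation p) t (a : rat) :
  (forall r, unavoidable E t r -> (a <= r%:R)%R) ->
  (a%:E <= rado_number E t)%E.
Proof.
move=> a_le; rewrite /rado_number; case: pselect => [ex_r|_]; last exact: leey.
by rewrite lee_fin; case: ex_minnP => r /asboolP /a_le.
Qed.

Import Order.TTheory GRing.Theory Num.Theory.

Theorem theorem8 (k t n b : nat) (c : 'I_k.-1 -> nat)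
    (hk : 2 <= k) (ht : 1 <= t) (hn : 1 <= n)
    (hc : forall i : 'I_k.-1, 0 < c i) (hb : 0 < b)
    (hs : coef_s c %| b)
    (hex : exists chi : coloring n t, excellent c chi) :
  ((b%:R / (coef_s c)%:R
     - (Num.ceil (b%:R / ((coef_s c)%:R * (n%:R + 1)) : rat))%:~R + 1)%R%:E
   <= rado_number (eq_b c b) t)%E.
Proof.
have [chi exc] := hex.
have s_gt0 : 0 < coef_s c by apply: dvdn_gt0 hs.
have [q b_eq] := dvdnP hs.
have q_gt0 : 0 < q by move: hb; rewrite b_eq muln_gt0 => /andP[].
have s_neq0 : ((coef_s c)%:R != 0 :> rat)%R by rewrite pnatr_eq0 -lt0n.
have n1_gt0 : (0 < n%:R + 1 :> rat)%R by rewrite natr1 ltr0n.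
have bs_q : (b%:R / (coef_s c)%:R = q%:R :> rat)%R by rewrite b_eq natrM mulfK.
rewrite invfM mulrA bs_q.
have ceil_gt0 : (0 < Num.ceil (q%:R / (n%:R + 1) : rat))%R.
  by rewrite ceil_gt0 divr_gt0 ?ltr0n.
have := ceil_ge (q%:R / (n%:R + 1) : rat)%R.
(* From here [d] is the ceiling, as a natural number. *)
case: (Num.ceil _) ceil_gt0 => // d d_gt0.
rewrite ler_pdivrMr // natr1 -[(d%:~R)%R]/(d%:R)%R -natrM ler_nat => q_le.
apply: rado_number_ge => r [_ unav]; rewrite leNgt; apply/negP => r_lt.
have r_le : r + d <= q.
  by move: r_lt; rewrite addrAC ltrBrDr natr1 -natrD ltr_nat ltnS.
have [chi' no_sol] := excellent_avoids_eq_b exc s_gt0 d_gt0 q_le r_le.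
by apply: no_sol; rewrite mulnC -b_eq; apply: unav.
Qed.
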